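(* Let $\mathbb{F}\in\{\mathbb{R},\mathbb{C}\}$, let $\mathcal{X}=\mathrm{span}\{X_1,\dots,X_k\}\subset\mathbb{F}^{n\times n}$ be a $k$-dimensional subspace, let $Y\in\mathbb{F}^{n\times n}\setminus\mathcal{X}$, and let $X_*\in\mathcal{X}$ be a spectral approximation of $Y$ from $\mathcal{X}$, i.e., $\|Y-X_*\|_2=\min_{X\in\mathcal{X}}\|Y-X\|_2$. Define $A_i=(Y-X_* )^HX_i$ for $i=1,\dots,k$ and $A_Y=(Y-X_* )^HY$. If the set $\mathscr{F}(A_1,\dots,A_k;\Sigma_{Y-X_*})$ or the set $\mathscr{F}(A_Y,A_1,\dots,A_k)$ is convex, then $$\max_{v\in\mathbb{F}^n,\ \|v\|_2=1}\ \min_{X\in\mathcal{X}}\|(Y-X)v\|_2=\min_{X\in\mathcal{X}}\ \max_{v\in\mathbb{F}^n,\ \|v\|_2=1}\|(Y-X)v\|_2.$$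
   Context: $\|v\|_2=(v^Hv)^{1/2}$ is the Euclidean norm on $\mathbb{F}^n$ and $\|A\|_2=\max_{v\in\mathbb{F}^n,\,\|v\|_2=1}\|Av\|_2$ is the spectral norm on $\mathbb{F}^{n\times n}$; $^H$ denotes the conjugate transpose. For an integer $m\ge 1$, matrices $B_1,\dots,B_m\in\mathbb{F}^{n\times n}$ and a subspace $\mathcal{S}\subseteq\mathbb{F}^n$ (over the same field $\mathbb{F}$), the $m$-dimensional field of the $m$ matrices $B_1,\dots,B_m$ restricted to $\mathcal{S}$ is $$\mathscr{F}(B_1,\dots,B_m;\mathcal{S})=\left\{[v^HB_1v,\dots,v^HB_mv]^T:\ v\in\mathcal{S},\ \|v\|_2=1\right\}\subset\mathbb{F}^m,$$ and $\mathscr{F}(B_1,\dots,B_m)=\mathscr{F}(B_1,\dots,B_m;\mathbb{F}^n)$. $\Sigma_{Y-X_*}\subseteq\mathbb{F}^n$ denotes the span of the maximal right singular vectors of $Y-X_*$, i.e., of the right singular vectors corresponding to the maximal singular value $\|Y-X_*\|_2$ of $Y-X_*$. *)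

(* Defs.v *)
From HB Require Import structures.
From mathcomp Require Import all_boot all_order all_algebra.
From mathcomp Require Import all_classical all_reals all_analysis.
From mathcomp Require Import complex.

Set Implicit Arguments.
Unset Strict Implicit.
Unset Printing Implicit Defensive.

Import Order.TTheory GRing.Theory Num.Theory.
Local Open Scope classical_set_scope.
Local Open Scope ring_scope.

Variant field_kind := RealField | ComplexField.

Definition scalar_field (R : realType) (K : field_kind) : numFieldType :=
  match K with RealField => R | ComplexField => R[i] end.

Definition conjF (R : realType) (K : field_kind) : scalar_field R K -> scalar_field R K :=
  match K return scalar_field R K -> scalar_field R K with
  | RealField => fun x => x
  | ComplexField => fun z : R[i] => conjc z
  end.

Definition real_part (R : realType) (K : field_kind) : scalar_field R K -> R :=
  match K return scalar_field R K -> R with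
  | RealField => fun x => x
  | ComplexField => fun z : R[i] => complex.Re z
  end.

Definition of_real (R : realType) (K : field_kind) : R -> scalar_field R K :=
  match K return R -> scalar_field R K with
  | RealField => fun x => x
  | ComplexField => fun x => real_complex R x
  end.

Section Notions.
Context {R : realType} {K : field_kind}.
Local Notation F := (scalar_field R K).

Definition adjoint (m n : nat) (A : 'M[F]_(m, n)) : 'M[F]_(n, m) :=
  map_mx (conjF (R := R) (K := K)) A^T.

(* [v^H v] is a nonnegative real; [real_part] only moves it from [F] to [R]. *)
Definition norm2 (n : nat) (v : 'cV[F]_n) : R :=
  Num.sqrt (real_part ((adjoint v *m v) 0 0)).

Definition unit_sphere {n : nat} : set 'cV[F]_n := [set v | norm2 v = 1].

(* The supremum is a maximum when 0 < n, by compactness; it is 0 when n = 0. *)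
Definition spectral_norm (n : nat) (A : 'M[F]_n) : R :=
  sup [set norm2 (A *m v) | v in unit_sphere].

(* Attained extrema: [m] is a value of [f] on [D] and bounds all the others. *)
Definition is_max (T : Type) (D : set T) (f : T -> R) (m : R) : Prop :=
  (exists2 x, D x & f x = m) /\ (forall x, D x -> f x <= m).

Definition is_min (T : Type) (D : set T) (f : T -> R) (m : R) : Prop :=
  (exists2 x, D x & f x = m) /\ (forall x, D x -> m <= f x).

(* The type of the points is the library's convex space on 'cV[F]_m, so that
   [convex_set] applies. When F = R[i] the coefficients range over the t : R[i]
   with 0 <= t <= 1, which in the order of R[i] are exactly the real numbers of
   [0, 1]: this is the usual real convexity in C^m. *)
Definition field_of_values (n m : nat) (B : 'I_m -> 'M[F]_n)
    (S : set 'cV[F]_n) : set (convex_lmodType 'cV[F]_m) :=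
  [set \col_i (adjoint v *m B i *m v) 0 0 | v in S `&` unit_sphere].

(* The family (A0, A 0, ..., A (k - 1)) of length k + 1. *)
Definition fam_cons (T : Type) (k : nat) (A0 : T) (A : 'I_k -> T) :
    'I_k.+1 -> T :=
  fun i => if unlift ord0 i is Some j then A j else A0.

Definition linear_span (n : nat) (V : set 'cV[F]_n) : set 'cV[F]_n :=
  [set w | exists (m : nat) (c : 'I_m -> F) (v : 'I_m -> 'cV[F]_n),
     (forall i, V (v i)) /\ w = \sum_i c i *: v i].

(* [u] is the left singular vector paired with [v]. *)
Definition right_singular_vector (n : nat) (A : 'M[F]_n) (s : R)
    (v : 'cV[F]_n) : Prop :=
  norm2 v = 1 /\
  exists u : 'cV[F]_n, [/\ norm2 u = 1, A *m v = of_real K s *: u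
                         & adjoint A *m u = of_real K s *: v].

Definition max_right_singular_span (n : nat) (A : 'M[F]_n) : set 'cV[F]_n :=
  linear_span [set v | right_singular_vector A (spectral_norm A) v].

End Notions.

(* Main.v *)
Require Import Defs.
From HB Require Import structures.
From mathcomp Require Import all_boot all_order all_algebra.
From mathcomp Require Import all_classical all_reals all_analysis.
From mathcomp Require Import complex ring lra.

Set Implicit Arguments.
Unset Strict Implicit.
Unset Printing Implicit Defensive.

Import Order.TTheory GRing.Theory Num.Theory.
Import numFieldNormedType.Exports.
Local Open Scope classical_set_scope.
Local Open Scope ring_scope.

(** Write [E = Y - X_*] and [s = ||E||].  For every unit [v], the inner minimum
    at [v] is at most [||E v|| <= s], and [s] is the min-max by optimality of
    [X_*]; so everything rests on one critical vector: a unit [v] with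
    [||E v|| = s] and [E v] orthogonal to [Z v] for all [Z] in the span.  By
    Pythagoras ([orthogonal_residual_min]) the inner minimum at such a [v] is
    exactly [s].

    In terms of [A_i = E^H X_i], the orthogonality says that the point
    [(v^H A_i v)_i] is [0].  Let [C] be the set of these points when [v] runs
    over the maximal unit vectors.  It is compact; suppose it is convex but
    misses [0], and let [c] be its point of least norm.  Least norm
    and convexity give [Re <c, a> >= |c|^2 > 0] for every [a] in [C].
    Since [Re <c, a>] is the real inner product of [E v] with [Z v] for
    [Z = sum conj(c_i) X_i], a small step along [Z] shortens [E v] uniformly
    near the maximal vectors, and away from them there is room to spare by
    compactness; hence [||E - t Z|| < s] ([spectral_descent]), against the
    optimality of [X_*].  This is [exists_critical_vector].

    The maximal unit vectors are exactly the unit vectors of the span of the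
    right singular vectors ([max_right_singular_spanP]), because a maximizer of
    the quadratic form of [E^H E] is an eigenvector; so the first convexity
    hypothesis is the convexity of [C].  The second one reduces to it: as
    [||E v||^2] is a real-linear function of the coordinates
    [v^H A_Y v], [v^H A_i v] ([rdot_residual]), the points over maximal vectors
    form a face of the larger field, and a face of a convex set is convex.

    Both scalar fields are handled together, through real and imaginary parts
    and the real inner product [rdot]; orthogonality to a subspace over the
    field and real orthogonality to it are the same thing. *)

(** * Real and imaginary parts of scalars *)

Section Scalars.
Context {R : realType} {K : field_kind}.
Local Notation F := (scalar_field R K).
Local Notation conj := (@conjF R K).
Local Notation re := (@real_part R K).
Local Notation ofR := (@of_real R K).

Definition imag_part : F -> R :=
  match K return scalar_field R K -> R with
  | RealField => fun=> 0
  | ComplexField => fun z : R[i] => complex.Im z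
  end.

(** Over the reals the second argument is dropped, so that [of_parts] is onto
    the field in both cases. *)
Definition of_parts : R -> R -> F :=
  match K return R -> R -> scalar_field R K with
  | RealField => fun a _ => a
  | ComplexField => fun a b => Complex a b
  end.
Local Notation im := imag_part.

Lemma conjF_is_additive : additive conj.
Proof. by move=> x y; case: K x y => //= x y; rewrite rmorphB. Qed.

Lemma conjF_is_multiplicative : multiplicative conj.
Proof.
split; first by move=> x y; case: K x y => //= x y; rewrite rmorphM.
by case: K => //=; rewrite oppr0.
Qed.

HB.instance Definition _ :=
  GRing.isAdditive.Build F F conj conjF_is_additive.
HB.instance Definition _ :=
  GRing.isMultiplicative.Build F F conj conjF_is_multiplicative.

Lemma real_part_is_additive : additive re.
Proof. by move=> x y; case: K x y => //= - [a b] [c d]. Qed.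

HB.instance Definition _ := GRing.isAdditive.Build F R re real_part_is_additive.

Lemma imag_part_is_additive : additive im.
Proof.
by rewrite /im => x y; case: K x y => //= [x y|[a b] [c d]]; rewrite ?subrr.
Qed.

HB.instance Definition _ := GRing.isAdditive.Build F R im imag_part_is_additive.

Lemma of_real_is_additive : additive ofR.
Proof. by move=> x y; case: K => //=; rewrite rmorphB. Qed.

HB.instance Definition _ := GRing.isAdditive.Build R F ofR of_real_is_additive.

Lemma conjFK : involutive conj.
Proof. by move=> x; case: K x => //= x; rewrite conjcK. Qed.

Lemma of_realM a b : ofR (a * b) = ofR a * ofR b.
Proof. by case: K => //=; rewrite rmorphM. Qed.

Lemma of_real1 : ofR 1 = 1.
Proof. by case: K. Qed.

Lemma of_real_le a b : (ofR a <= ofR b) = (a <= b).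
Proof. by case: K => //=; rewrite lecR. Qed.

Lemma re_of_real a : re (ofR a) = a.
Proof. by case: K. Qed.

Lemma im_of_real a : im (ofR a) = 0.
Proof. by rewrite /im; case: K. Qed.

Lemma re_of_realM a x : re (ofR a * x) = a * re x.
Proof. by case: K x => //= - [b c] /=; rewrite mul0r subr0. Qed.

Lemma re_conj x : re (conj x) = re x.
Proof. by case: K x => //= - []. Qed.

Lemma im_conj x : im (conj x) = - im x.
Proof. by rewrite /im; case: K x => //= [_|[]//]; rewrite oppr0. Qed.

Lemma reM x y : re (x * y) = re x * re y - im x * im y.
Proof.
by rewrite /im; case: K x y => /= [x y|[a b] [c d]//]; rewrite mul0r subr0.
Qed.

Lemma imM x y : im (x * y) = re x * im y + im x * re y.
Proof.
by rewrite /im; case: K x y => /= [x y|[a b] [c d]//];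
  rewrite mul0r mulr0 addr0.
Qed.

Lemma of_partsK x : of_parts (re x) (im x) = x.
Proof. by rewrite /of_parts /im; case: K x => //= - []. Qed.

Lemma re_of_parts a b : re (of_parts a b) = a.
Proof. by rewrite /of_parts; case: K. Qed.

Lemma re_conjM x : re (conj x * x) = re x ^+ 2 + im x ^+ 2.
Proof. by rewrite reM re_conj im_conj; ring. Qed.

End Scalars.

(** * The real inner product of [F^n] *)

Section RealInnerProduct.
Context {R : realType} {K : field_kind}.
Local Notation F := (scalar_field R K).
Local Notation conj := (@conjF R K).
Local Notation re := (@real_part R K).
Local Notation ofR := (@of_real R K).

Lemma adjointM m n p (A : 'M[F]_(m, n)) (B : 'M[F]_(n, p)) :
  adjoint (A *m B) = adjoint B *m adjoint A.
Proof. by rewrite /adjoint trmx_mul map_mxM. Qed.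

(** [F^n] as a real Euclidean space; the real structure is enough for norms,
    convexity and descent. *)
Definition rdot n (u v : 'cV[F]_n) : R := re ((adjoint u *m v) 0 0).

Lemma norm2E n (v : 'cV[F]_n) : norm2 v = Num.sqrt (rdot v v).
Proof. by []. Qed.

Lemma rdotDl n (u v w : 'cV[F]_n) : rdot (u + v) w = rdot u w + rdot v w.
Proof. by rewrite /rdot /adjoint linearD map_mxD mulmxDl mxE raddfD. Qed.

Lemma rdotDr n (u v w : 'cV[F]_n) : rdot u (v + w) = rdot u v + rdot u w.
Proof. by rewrite /rdot mulmxDr mxE raddfD. Qed.

Lemma rdotZr n a (u v : 'cV[F]_n) : rdot u (ofR a *: v) = a * rdot u v.
Proof. by rewrite /rdot -scalemxAr mxE re_of_realM. Qed.

Lemma rdotC n (u v : 'cV[F]_n) : rdot u v = rdot v u.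
Proof.
rewrite /rdot -[in LHS](re_conj (_ 0 0)); congr re.
rewrite /adjoint !mxE rmorph_sum; apply: eq_bigr => i _.
by rewrite rmorphM /= !mxE conjFK mulrC.
Qed.

Lemma rdotZl n a (u v : 'cV[F]_n) : rdot (ofR a *: u) v = a * rdot u v.
Proof. by rewrite rdotC rdotZr rdotC. Qed.

Lemma rdotNr n (u v : 'cV[F]_n) : rdot u (- v) = - rdot u v.
Proof. by rewrite /rdot mulmxN mxE raddfN. Qed.

Lemma rdotNl n (u v : 'cV[F]_n) : rdot (- u) v = - rdot u v.
Proof. by rewrite rdotC rdotNr rdotC. Qed.

Lemma rdot0l n (v : 'cV[F]_n) : rdot 0 v = 0.
Proof. by rewrite -(subrr v) rdotDl rdotNl subrr. Qed.

Lemma rdot_sqrD n (u v : 'cV[F]_n) :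
  rdot (u + v) (u + v) = rdot u u + 2 * rdot u v + rdot v v.
Proof. by rewrite rdotDl !rdotDr (rdotC v u); ring. Qed.

Lemma rdot_mull m n (A : 'M[F]_(m, n)) u v :
  rdot (A *m u) v = rdot u (adjoint A *m v).
Proof. by rewrite /rdot adjointM mulmxA. Qed.

Lemma rdot_sumE n (v : 'cV[F]_n) :
  rdot v v = \sum_i (re (v i 0) ^+ 2 + imag_part (v i 0) ^+ 2).
Proof.
rewrite /rdot mxE raddf_sum; apply: eq_bigr => i _.
by rewrite /= !mxE re_conjM.
Qed.

Lemma rdot_ge0 n (v : 'cV[F]_n) : 0 <= rdot v v.
Proof. by rewrite rdot_sumE sumr_ge0 // => i _; rewrite addr_ge0 ?sqr_ge0. Qed.

Lemma sqr_part_le_rdot n (v : 'cV[F]_n) i :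
  re (v i 0) ^+ 2 + imag_part (v i 0) ^+ 2 <= rdot v v.
Proof.
rewrite rdot_sumE (bigD1 i) //= lerDl sumr_ge0 // => j _.
by rewrite addr_ge0 ?sqr_ge0.
Qed.

Lemma rdot_eq0 n (v : 'cV[F]_n) : rdot v v = 0 -> v = 0.
Proof.
move=> v0; apply/matrixP => i j; rewrite ord1 mxE.
have := sqr_part_le_rdot v i; rewrite v0 => le0.
have s1 := sqr_ge0 (re (v i 0)); have s2 := sqr_ge0 (imag_part (v i 0)).
rewrite -(of_partsK (v i 0)).
have /eqP -> : re (v i 0) == 0 by rewrite -sqrf_eq0; apply/eqP; lra.
have /eqP -> : imag_part (v i 0) == 0 by rewrite -sqrf_eq0; apply/eqP; lra.
by rewrite -[RHS]of_partsK raddf0 (raddf0 (@imag_part R K)).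
Qed.

Lemma unit_sphereE n (v : 'cV[F]_n) : unit_sphere v <-> rdot v v = 1.
Proof.
rewrite /unit_sphere /= norm2E; split => [h|->]; last exact: sqrtr1.
by rewrite -(sqr_sqrtr (rdot_ge0 v)) h expr1n.
Qed.

Lemma norm2_le n m (u : 'cV[F]_n) (v : 'cV[F]_m) :
  (norm2 u <= norm2 v) = (rdot u u <= rdot v v).
Proof. by rewrite !norm2E ler_sqrt // rdot_ge0. Qed.

Lemma sqr_norm2 n (v : 'cV[F]_n) : norm2 v ^+ 2 = rdot v v.
Proof. by rewrite norm2E sqr_sqrtr // rdot_ge0. Qed.

Lemma gram_eq0 m n (M : 'M[F]_(m, n)) : adjoint M *m M = 0 -> M = 0.
Proof.
move=> M0; apply/matrixP => i j; rewrite [RHS]mxE.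
have /rdot_eq0 /matrixP /(_ i 0) : rdot (col j M) (col j M) = 0.
  by rewrite colE rdot_mull mulmxA M0 mul0mx rdotC rdot0l.
by rewrite !mxE.
Qed.

(** The least squares problem [min_c ||y - N c||] is solvable: [N^H N] and
    [N^H] have the same column space, as anything annihilated by [N^H N] is
    annihilated by [N]. *)
Lemma normal_equations m n (N : 'M[F]_(m, n)) (y : 'cV[F]_m) :
  exists c : 'cV[F]_n, adjoint N *m (y - N *m c) = 0.
Proof.
(* Row spaces are what the rank theory compares, hence the transposes. *)
pose P := cokermx (adjoint N *m N)^T.
pose M := (adjoint N)^T.
have adjM : adjoint M = N^T.
  by apply/matrixP => i j; rewrite /adjoint !mxE conjFK.
have MP0 : M *m P = 0.
  apply: gram_eq0; rewrite adjointM adjM -mulmxA.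
  have -> : N^T *m (M *m P) = 0 by rewrite mulmxA -trmx_mul mulmx_coker.
  by rewrite mulmx0.
have /submxP[d dE] : ((adjoint N *m y)^T <= (adjoint N *m N)^T)%MS.
  by rewrite submxE trmx_mul -mulmxA -/P -/M MP0 mulmx0.
exists d^T; rewrite mulmxBr; apply/eqP; rewrite subr_eq0; apply/eqP.
by rewrite -[LHS]trmxK dE trmx_mul trmxK mulmxA.
Qed.

End RealInnerProduct.

(** * Compactness of the unit sphere *)

Section Compactness.
Context {R : realType} {K : field_kind}.
Local Notation F := (scalar_field R K).
Local Notation conj := (@conjF R K).
Local Notation re := (@real_part R K).
Local Notation im := (@imag_part R K).

(** A linear surjection of [R^(2n)] onto [F^n], along which the compactness of
    boxes and the continuity of real polynomials are carried to [F^n]. *)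
Definition of_coords n (x : 'rV[R]_(n + n)) : 'cV[F]_n :=
  \col_i of_parts (x 0 (lshift n i)) (x 0 (rshift n i)).

Definition coord_cts n (f : 'cV[F]_n -> R) : Prop :=
  continuous (fun x => f (of_coords x)).

Definition entry_cts n p q (f : 'cV[F]_n -> 'M[F]_(p, q)) : Prop :=
  forall i j, coord_cts (fun v => re (f v i j)) /\
              coord_cts (fun v => im (f v i j)).

Lemma coord_ctsD n (f g : 'cV[F]_n -> R) :
  coord_cts f -> coord_cts g -> coord_cts (fun v => f v + g v).
Proof. by move=> cf cg x; apply: continuousD; [exact: cf|exact: cg]. Qed.

Lemma coord_ctsN n (f : 'cV[F]_n -> R) :
  coord_cts f -> coord_cts (fun v => - f v).
Proof. by move=> cf x; apply: continuousN; exact: cf. Qed.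

Lemma coord_ctsM n (f g : 'cV[F]_n -> R) :
  coord_cts f -> coord_cts g -> coord_cts (fun v => f v * g v).
Proof. by move=> cf cg x; apply: continuousM; [exact: cf|exact: cg]. Qed.

Lemma coord_cts_cst n (c : R) : coord_cts (fun _ : 'cV[F]_n => c).
Proof. by move=> x; exact: cst_continuous. Qed.

Lemma coord_cts_sum n (I : finType) (f : I -> 'cV[F]_n -> R) :
  (forall i, coord_cts (f i)) -> coord_cts (fun v => \sum_i f i v).
Proof.
move=> cf; elim: (index_enum I) => [|i s IHs].
  by under eq_fun do rewrite big_nil; exact: coord_cts_cst.
by under eq_fun do rewrite big_cons; exact: (coord_ctsD (cf i) IHs).
Qed.

Lemma entry_cts_id n : entry_cts (fun v : 'cV[F]_n => v).
Proof.
move=> i j; rewrite /coord_cts /of_coords; split.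
  by under eq_fun do rewrite mxE re_of_parts; exact: coord_continuous.
under eq_fun do rewrite mxE.
rewrite /of_parts /imag_part; case: K => /=; first exact: cst_continuous.
exact: coord_continuous.
Qed.

Lemma entry_cts_cst n p q (A : 'M[F]_(p, q)) :
  entry_cts (fun _ : 'cV[F]_n => A).
Proof. by move=> i j; split; exact: coord_cts_cst. Qed.

Lemma entry_cts_mul n p q r (f : 'cV[F]_n -> 'M[F]_(p, q))
    (g : 'cV[F]_n -> 'M[F]_(q, r)) :
  entry_cts f -> entry_cts g -> entry_cts (fun v => f v *m g v).
Proof.
move=> cf cg i j; split.
  have -> : (fun v => re ((f v *m g v) i j)) = fun v =>
      \sum_k (re (f v i k) * re (g v k j) + - (im (f v i k) * im (g v k j))).
    apply/funext => v; rewrite mxE raddf_sum; apply: eq_bigr => k _.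
    by rewrite /= reM.
  apply: (@coord_cts_sum _ _ (fun k v => _)) => k.
  exact: coord_ctsD (coord_ctsM (cf i k).1 (cg k j).1)
           (coord_ctsN (coord_ctsM (cf i k).2 (cg k j).2)).
have -> : (fun v => im ((f v *m g v) i j)) = fun v =>
    \sum_k (re (f v i k) * im (g v k j) + im (f v i k) * re (g v k j)).
  apply/funext => v; rewrite mxE raddf_sum; apply: eq_bigr => k _.
  by rewrite /= imM.
apply: (@coord_cts_sum _ _ (fun k v => _)) => k.
exact: coord_ctsD (coord_ctsM (cf i k).1 (cg k j).2)
         (coord_ctsM (cf i k).2 (cg k j).1).
Qed.

Lemma entry_cts_adjoint n p q (f : 'cV[F]_n -> 'M[F]_(p, q)) :
  entry_cts f -> entry_cts (fun v => adjoint (f v)).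
Proof.
move=> cf i j; rewrite /adjoint; split.
  by under eq_fun do rewrite !mxE re_conj; exact: (cf j i).1.
by under eq_fun do rewrite !mxE im_conj; exact: (coord_ctsN (cf j i).2).
Qed.

Lemma coord_cts_rdot n p (f g : 'cV[F]_n -> 'cV[F]_p) :
  entry_cts f -> entry_cts g -> coord_cts (fun v => rdot (f v) (g v)).
Proof.
by move=> cf cg; exact: (entry_cts_mul (entry_cts_adjoint cf) cg 0 0).1.
Qed.

Lemma coord_cts_rdot_mul n p (A B : 'M[F]_(p, n)) :
  coord_cts (fun v => rdot (A *m v) (B *m v)).
Proof.
have cts_mul C : entry_cts (fun v : 'cV[F]_n => C *m v :> 'cV[F]_p).
  exact (entry_cts_mul (@entry_cts_cst n _ _ C) (@entry_cts_id n)).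
exact (coord_cts_rdot (cts_mul A) (cts_mul B)).
Qed.

(** Real and imaginary parts of the entries of a unit vector lie in [[-1, 1]],
    so the sphere and its closed subsets are images of compact sets of
    coordinate rows.  The constraint [c <= g v] selects the maximal vectors, or
    the vectors far from them. *)
Lemma sphere_max_on n (f g : 'cV[F]_n -> R) (c : R) :
    coord_cts f -> coord_cts g ->
    (exists2 v, unit_sphere v & c <= g v) ->
  exists v0, [/\ unit_sphere v0, c <= g v0 &
    forall v, unit_sphere v -> c <= g v -> f v <= f v0].
Proof.
move=> cf cg [w w1 cw].
(* Over the reals [of_coords] has a kernel, so the preimage of the sphere is
   unbounded: the box is needed besides the equation. *)
pose box := [set x : 'rV[R]_(n + n) | forall i,
  `[(-1 : R), 1]%classic (x ord0 i)].
pose D := box `&` [set x | rdot (of_coords x : 'cV[F]_n) (of_coords x) = 1]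
              `&` [set x | c <= g (of_coords x)].
have cptbox : compact box.
  apply: (rV_compact (A := fun=> `[(-1 : R), 1]%classic)) => _.
  exact: segment_compact.
have D_of v : unit_sphere v -> c <= g v -> exists2 x, D x & of_coords x = v.
  move=> /unit_sphereE v1 cv.
  pose x : 'rV[R]_(n + n) :=
    row_mx (\row_i re (v i 0)) (\row_i im (v i 0)).
  have xv : of_coords x = v.
    by apply/colP => i; rewrite mxE row_mxEl row_mxEr !mxE of_partsK.
  exists x => //; rewrite /D /= xv; split=> //; split=> //.
  have sq_le (a b : R) : a ^+ 2 + b ^+ 2 <= 1 -> a \in `[(-1 : R), 1].
    by move=> ab; rewrite in_itv /=; apply/andP; split; nra.
  move=> i; rewrite mxE; case: splitP => j _; rewrite mxE;
    have := sqr_part_le_rdot v j; rewrite v1; first exact: sq_le.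
  by rewrite addrC; exact: sq_le.
have cptD : compact D.
  apply: (subclosed_compact _ cptbox); last by move=> x [[]].
  apply: closedI; [apply: closedI|].
  - exact: compact_closed cptbox.
  - have cts1 : coord_cts (fun v : 'cV[F]_n => rdot v v).
      exact (coord_cts_rdot (@entry_cts_id n) (@entry_cts_id n)).
    exact: (preimage_closed (fun x _ => cts1 x) (@closed_eq _ _)).
  - exact: (preimage_closed (fun x _ => cg x) (@closed_ge _ _)).
have [||x0 /set_mem [[_ x01] cx0] maxx] :=
    compact_EVT_max (f := fun x => f (of_coords x)) _ cptD.
- by have [x Dx _] := D_of w w1 cw; exists x.
- exact/continuous_subspaceT.
exists (of_coords x0); split=> //; first exact/unit_sphereE.
by move=> v v1 cv; have [x Dx <-] := D_of v v1 cv; apply/maxx/mem_set.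
Qed.

Lemma sphere_max n (f : 'cV[F]_n -> R) :
    coord_cts f -> (0 < n)%N ->
  exists2 v0, unit_sphere v0 & forall v, unit_sphere v -> f v <= f v0.
Proof.
case: n f => // n f cf _.
have [|v0 [v01 _ maxf]] := sphere_max_on (c := 0) cf (@coord_cts_cst n.+1 0).
  exists (delta_mx 0 0) => //; apply/unit_sphereE.
  rewrite rdot_sumE (bigD1 0) //= big1 => [|i i0].
    rewrite mxE eqxx -[(_ && _)%:R](@of_real1 R K) re_of_real im_of_real.
    by rewrite expr1n expr0n !addr0.
  by rewrite !mxE (negbTE i0) /= !raddf0 expr0n addr0.
by exists v0 => // v v1; exact: maxf.
Qed.

End Compactness.
Arguments coord_cts_rdot_mul {R K n p} A B.

(** * Spectral norm and maximal vectors *)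

(** First-order optimality at the endpoint of a segment. *)
Lemma quadratic_ge0_slope (R : realFieldType) (a b : R) :
  (forall t, 0 < t -> t <= 1 -> 0 <= 2 * t * a + t ^+ 2 * b) -> 0 <= a.
Proof.
move=> h; rewrite leNgt; apply/negP => a0.
have d0 : 0 < `|b| + 1 - a by have := normr_ge0 b; lra.
(* [t] is at most [1] and makes the quadratic term at most half of [2 t |a|]. *)
pose t := - a / (`|b| + 1 - a).
have t0 : 0 < t by rewrite divr_gt0 // oppr_gt0.
have t1 : t <= 1 by rewrite ler_pdivrMr // mul1r; have := normr_ge0 b; lra.
have tb : t * b <= - a.
  apply: le_trans (ler_norm _) _; rewrite normrM (gtr0_norm t0).
  rewrite /t mulrAC ler_pdivrMr // ler_pM2l ?oppr_gt0 //; lra.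
have := h t t0 t1.
have -> : 2 * t * a + t ^+ 2 * b = t * (2 * a + t * b) by ring.
by rewrite pmulr_rge0 //; lra.
Qed.

Section SpectralNorm.
Context {R : realType} {K : field_kind}.
Local Notation F := (scalar_field R K).
Local Notation ofR := (@of_real R K).

Lemma spectral_norm_max n (A : 'M[F]_n) : (0 < n)%N ->
  is_max (unit_sphere : set 'cV[F]_n) (fun v => norm2 (A *m v))
    (spectral_norm A).
Proof.
move=> n0; have [v0 v01 maxA] := sphere_max (coord_cts_rdot_mul A A) n0.
have ubA v : unit_sphere v -> norm2 (A *m v) <= norm2 (A *m v0).
  by move=> v1; rewrite norm2_le; exact: maxA.
suff -> : spectral_norm A = norm2 (A *m v0) by split => //; exists v0.
apply/le_anti/andP; split.
  apply: ge_sup; first by exists (norm2 (A *m v0)), v0.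
  by move=> _ [v v1 <-]; exact: ubA.
apply: ub_le_sup; last by exists v0.
by exists (norm2 (A *m v0)) => _ [v v1 <-]; exact: ubA.
Qed.

Section Maximal.
Context {n : nat} (n_gt0 : (0 < n)%N) (A : 'M[F]_n).
Local Notation s := (spectral_norm A).

Lemma spectral_norm_ge0 : 0 <= s.
Proof. by have [[v _ <-] _] := spectral_norm_max A n_gt0; exact: sqrtr_ge0. Qed.

Lemma sphere_le_spectral (v : 'cV[F]_n) :
  unit_sphere v -> rdot (A *m v) (A *m v) <= s ^+ 2.
Proof.
move=> v1; rewrite -sqr_norm2 ler_sqr ?nnegrE ?spectral_norm_ge0 ?sqrtr_ge0 //.
exact: (spectral_norm_max A n_gt0).2.
Qed.

Lemma rdot_le_spectral (v : 'cV[F]_n) :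
  rdot (A *m v) (A *m v) <= s ^+ 2 * rdot v v.
Proof.
have [v0|] := eqVneq (rdot v v) 0.
  by rewrite (rdot_eq0 v0) mulmx0 !rdot0l mulr0.
move=> vn0; have vgt0 : 0 < rdot v v by rewrite lt_neqAle eq_sym vn0 rdot_ge0.
pose a := (norm2 v)^-1.
have a2 : a ^+ 2 * rdot v v = 1 by rewrite exprVn sqr_norm2 mulVf.
have := @sphere_le_spectral (ofR a *: v).
rewrite unit_sphereE -scalemxAr !rdotZl !rdotZr !mulrA -!expr2 => /(_ a2) le.
have := ler_wpM2r (rdot_ge0 v) le.
by rewrite mulrAC a2 mul1r.
Qed.

(** The form [s^2 |v|^2 - |A v|^2] is nonnegative and vanishes at [v], so its
    gradient [2 w] at [v] vanishes: a step against it would make the form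
    negative. *)
Lemma maximal_eigen (v : 'cV[F]_n) :
    unit_sphere v -> rdot (A *m v) (A *m v) = s ^+ 2 ->
  adjoint A *m (A *m v) = ofR (s ^+ 2) *: v.
Proof.
move=> /unit_sphereE v1 vmax.
pose w := ofR (s ^+ 2) *: v - adjoint A *m (A *m v).
suff /rdot_eq0/eqP : rdot w w = 0 by rewrite subr_eq0 => /eqP <-.
have ww : rdot w w = s ^+ 2 * rdot v w - rdot (A *m v) (A *m w).
  rewrite {1}/w rdotDl rdotNl rdotZl; congr (_ - _).
  by rewrite rdotC -rdot_mull rdotC.
(* The step [- t] goes against the gradient, whence the sign of the slope. *)
clearbody w; apply/le_anti; rewrite rdot_ge0 andbT -oppr_ge0.
apply: (@quadratic_ge0_slope _ _ (s ^+ 2 * rdot w w - rdot (A *m w) (A *m w))).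
move=> t _ _; have := rdot_le_spectral (v + ofR (- t) *: w).
rewrite mulmxDr -scalemxAr !rdot_sqrD !rdotZl !rdotZr v1 vmax ww -subr_ge0.
by congr (0 <= _); ring.
Qed.

Lemma spectral_norm_gt0 : A != 0 -> 0 < s.
Proof.
move=> A0; rewrite lt_neqAle spectral_norm_ge0 andbT eq_sym.
apply: contra A0 => /eqP s0; apply/eqP/matrixP => i j.
have : A *m delta_mx j (0 : 'I_1) = 0.
  apply: rdot_eq0; apply/le_anti; rewrite rdot_ge0 andbT.
  by have := rdot_le_spectral (delta_mx j (0 : 'I_1)); rewrite s0 expr0n mul0r.
by rewrite -colE => /matrixP/(_ i 0); rewrite !mxE.
Qed.

Lemma right_singular_eigen (v : 'cV[F]_n) :
  right_singular_vector A s v -> adjoint A *m (A *m v) = ofR (s ^+ 2) *: v.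
Proof.
move=> [_ [u [_ -> Au]]].
by rewrite -scalemxAr Au scalerA -of_realM expr2.
Qed.

(** The maximal right singular vectors are the unit vectors of an eigenspace of
    [A^H A], so taking their span adds no new unit vectors. *)
Lemma max_right_singular_spanP (v : 'cV[F]_n) : 0 < s -> unit_sphere v ->
  max_right_singular_span A v <-> rdot (A *m v) (A *m v) = s ^+ 2.
Proof.
move=> s0 v1; split.
  case=> m [c [w [wE vE]]].
  have Ev : adjoint A *m (A *m v) = ofR (s ^+ 2) *: v.
    rewrite {}vE !linear_sum; apply: eq_bigr => i _.
    by rewrite /= -!scalemxAr (right_singular_eigen (wE i)) !scalerA mulrC.
  by rewrite rdot_mull Ev rdotZr (unit_sphereE v).1 // mulr1.
move=> vmax; have Ev := maximal_eigen v1 vmax.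
exists 1%N, (fun=> 1), (fun=> v); split=> [_|]; last first.
  by rewrite big_ord1 scale1r.
have sK : ofR s * ofR s^-1 = 1 by rewrite -of_realM divff ?gt_eqF // of_real1.
split=> //; exists (ofR s^-1 *: (A *m v)); split.
- apply/unit_sphereE; rewrite rdotZl rdotZr vmax expr2 mulrA -mulrA.
  by field; rewrite gt_eqF.
- by rewrite scalerA sK scale1r.
- rewrite -scalemxAr Ev scalerA -of_realM; congr (ofR _ *: _).
  by field; rewrite gt_eqF.
Qed.

(** Where [<A v, Z v> > d / 2], a small step [t] gains a multiple of [t].  The
    remaining unit vectors form a compact set without maximal vectors, on which
    [|A v|^2] stays below [s^2 - e] for some [e > 0]. *)
Lemma spectral_descent (Z : 'M[F]_n) (d : R) : 0 < s -> 0 < d ->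
    (forall v, unit_sphere v -> rdot (A *m v) (A *m v) = s ^+ 2 ->
       d <= rdot (A *m v) (Z *m v)) ->
  exists t, spectral_norm (A - ofR t *: Z) < s.
Proof.
move=> s0 d0 acute.
have [M M0 leM] : exists2 M, 0 <= M &
    forall v, unit_sphere v -> rdot (Z *m v) (Z *m v) <= M.
  have [v _ maxZ] := sphere_max (coord_cts_rdot_mul Z Z) n_gt0.
  by exists (rdot (Z *m v) (Z *m v)) => //; exact: rdot_ge0.
have [e e0 gap] : exists2 e, 0 < e & forall v, unit_sphere v ->
    rdot (A *m v) (Z *m v) <= d / 2 -> rdot (A *m v) (A *m v) <= s ^+ 2 - e.
  have [ex|nex] := pselect (exists2 v : 'cV[F]_n, unit_sphere v &
      - (d / 2) <= - rdot (A *m v) (Z *m v)).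
    have [v [v1 vd maxv]] := sphere_max_on (coord_cts_rdot_mul A A)
      (coord_ctsN (coord_cts_rdot_mul A Z)) ex.
    exists (s ^+ 2 - rdot (A *m v) (A *m v)).
      rewrite subr_gt0 lt_neqAle sphere_le_spectral // andbT.
      by apply/eqP => /(acute v v1); lra.
    by move=> w w1 wd; rewrite opprB addrC subrK maxv // lerN2.
  exists 1 => // v v1 vd; case: nex; exists v => //; by rewrite lerN2.
have s20 : 0 < s ^+ 2 by rewrite exprn_gt0.
(* The bound [d / (M + 1)] serves the vectors at an acute angle, the other one
   those where only [- 2 <A v, Z v> <= s^2 + M] is known. *)
pose t := Num.min 1 (Num.min (d / (M + 1)) (e / (s ^+ 2 + 2 * M + 1))).
have t0 : 0 < t by rewrite !lt_min ltr01 !divr_gt0 //; lra.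
have t1 : t <= 1 by rewrite ge_min lexx.
have td : t * (M + 1) <= d.
  by rewrite -ler_pdivlMr; [rewrite !ge_min lexx orbT|lra].
have te : t * (s ^+ 2 + 2 * M + 1) <= e.
  by rewrite -ler_pdivlMr; [rewrite !ge_min lexx !orbT|lra].
exists t; have [[v v1 <-] _] := spectral_norm_max (A - ofR t *: Z) n_gt0.
rewrite -ltr_sqr ?nnegrE ?spectral_norm_ge0 ?sqrtr_ge0 // sqr_norm2.
rewrite mulmxBl -scalemxAl rdot_sqrD rdotNl !rdotNr opprK rdotZl !rdotZr.
have lA := sphere_le_spectral v1; have lZ := leM v v1.
have tt : t * t <= t by rewrite ler_piMr // ltW.
have ttZ : t * (t * rdot (Z *m v) (Z *m v)) <= t * (t * M).
  by rewrite !ler_pM2l.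
have [rd|rd] := leP (rdot (A *m v) (Z *m v)) (d / 2).
  have lAe := gap v v1 rd.
  have := rdot_ge0 (A *m v + Z *m v); rewrite rdot_sqrD => cs.
  have : t * (- (2 * rdot (A *m v) (Z *m v))) <= t * (s ^+ 2 + M).
    by rewrite ler_pM2l //; lra.
  have : t * t * M <= t * M by rewrite ler_wpM2r.
  lra.
have : t * (d / 2) < t * rdot (A *m v) (Z *m v) by rewrite ltr_pM2l.
have : t * (t * (M + 1)) <= t * d by rewrite ler_pM2l.
have : 0 < t * t by rewrite mulr_gt0.
lra.
Qed.
End Maximal.
End SpectralNorm.

(** * Residuals, fields of values and critical vectors *)

Section Combinations.
Context {R : realType} {K : field_kind} {n k : nat}.
Local Notation F := (scalar_field R K).
Local Notation conj := (@conjF R K).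
Local Notation re := (@real_part R K).
Local Notation ofR := (@of_real R K).
Implicit Types (X : k.-tuple 'M[F]_n) (c : 'cV[F]_k) (v : 'cV[F]_n).

Definition lincomb X c : 'M[F]_n := \sum_i c i 0 *: tnth X i.

Definition image_mx X v : 'M[F]_(n, k) := \matrix_(i, j) (tnth X j *m v) i 0.

Lemma mem_span_lincomb X Z :
  Z \in <<X>>%VS <-> exists c, Z = lincomb X c.
Proof.
split=> [XZ|[c ->]].
  exists (\col_i coord X i Z); rewrite {1}(coord_span XZ).
  by apply: eq_bigr => i _; rewrite mxE -tnth_nth.
by apply: memv_suml => i _; rewrite memvZ // memv_span // mem_tnth.
Qed.

Lemma lincomb_mulE X c v : lincomb X c *m v = image_mx X v *m c.
Proof.
rewrite mulmx_suml; apply/colP => i; rewrite !mxE summxE.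
by apply: eq_bigr => j _; rewrite -scalemxAl !mxE mulrC.
Qed.

Lemma lincombZ X a c : lincomb X (a *: c) = a *: lincomb X c.
Proof.
by rewrite scaler_sumr; apply: eq_bigr => i _; rewrite mxE scalerA.
Qed.

(** The vectors [Z v] with [Z] in the span form a subspace, onto which [Y v] is
    projected. *)
Lemma exists_orthogonal_residual X (Y : 'M[F]_n) v :
  exists2 Z, Z \in <<X>>%VS &
    forall Z', Z' \in <<X>>%VS -> rdot ((Y - Z) *m v) (Z' *m v) = 0.
Proof.
have [c cE] := normal_equations (image_mx X v) (Y *m v).
exists (lincomb X c); first by apply/mem_span_lincomb; exists c.
move=> _ /mem_span_lincomb[c' ->].
by rewrite mulmxBl !lincomb_mulE rdotC rdot_mull cE rdotC rdot0l.
Qed.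

Lemma orthogonal_residual_min X (Y Z : 'M[F]_n) v :
    Z \in <<X>>%VS ->
    (forall Z', Z' \in <<X>>%VS -> rdot ((Y - Z) *m v) (Z' *m v) = 0) ->
  is_min [set Z' | Z' \in <<X>>%VS] (fun Z' => norm2 ((Y - Z') *m v))
    (norm2 ((Y - Z) *m v)).
Proof.
move=> XZ orth; split; first by exists Z.
move=> Z' XZ'; rewrite norm2_le.
have -> : Y - Z' = (Y - Z) + (Z - Z') by rewrite addrA subrK.
rewrite (mulmxDl (Y - Z)) rdot_sqrD (orth (Z - Z')) ?memvB //.
by rewrite mulr0 addr0 lerDl rdot_ge0.
Qed.

Definition form_vec (B : 'I_k -> 'M[F]_n) v : 'cV[F]_k :=
  \col_i (adjoint v *m B i *m v) 0 0.

Lemma coord_cts_form_vec (B : 'I_k -> 'M[F]_n) :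
  coord_cts (fun v => rdot (form_vec B v) (form_vec B v)).
Proof.
have cts : entry_cts (form_vec B).
  move=> i j; rewrite /form_vec.
  have ctsB : entry_cts (fun v => adjoint v *m B i *m v).
    exact (entry_cts_mul
      (entry_cts_mul (entry_cts_adjoint (@entry_cts_id R K n))
        (@entry_cts_cst R K n _ _ (B i))) (@entry_cts_id R K n)).
  split; under eq_fun do rewrite mxE; [exact (ctsB 0 0).1|exact (ctsB 0 0).2].
exact (coord_cts_rdot cts cts).
Qed.

(** Links the Euclidean structure of the field of values with that of [F^n]: the
    functional [<c, _>] on the former is the derivative of [|E v|^2 / 2] in the
    direction [lincomb X (conj c)]. *)
Lemma rdot_lincomb_conj (E : 'M[F]_n) X c v :
  rdot (E *m v) (lincomb X (map_mx conj c) *m v) =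
  rdot c (form_vec (fun i => adjoint E *m tnth X i) v).
Proof.
rewrite /rdot mulmx_suml mulmx_sumr summxE [in RHS]mxE; congr re.
apply: eq_bigr => i _.
rewrite -scalemxAl -scalemxAr [LHS]mxE [map_mx conj c i 0]mxE.
have -> : adjoint c 0 i = conj (c i 0) by rewrite /adjoint !mxE.
by rewrite [form_vec _ _ _ _]mxE adjointM !mulmxA.
Qed.

(** Optimality forces [0] into the field of values on the maximal vectors as
    soon as that field is convex: the conjugate coefficients of its point of
    least norm would otherwise give a direction of descent. *)
Lemma exists_critical_vector X (E : 'M[F]_n)
    (B := fun i => adjoint E *m tnth X i)
    (S := fun v => unit_sphere v /\
            rdot (E *m v) (E *m v) = spectral_norm E ^+ 2) :
    (0 < n)%N -> 0 < spectral_norm E ->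
    (forall c, spectral_norm E <= spectral_norm (E - lincomb X c)) ->
    (forall v w t, S v -> S w -> 0 <= t -> t <= 1 -> exists2 u, S u &
       form_vec B u = ofR t *: form_vec B v + ofR (1 - t) *: form_vec B w) ->
  exists2 v, S v & form_vec B v = 0.
Proof.
move=> n_gt0 s0 best cvx.
have Sle v : unit_sphere v ->
    spectral_norm E ^+ 2 <= rdot (E *m v) (E *m v) -> S v.
  by move=> v1 le; split=> //; apply/le_anti; rewrite sphere_le_spectral.
have ex : exists2 v, unit_sphere v &
    spectral_norm E ^+ 2 <= rdot (E *m v) (E *m v).
  have [[v v1 vs] _] := spectral_norm_max E n_gt0.
  by exists v => //; rewrite -vs sqr_norm2.
have [v0 [v01 v0s minv0]] := sphere_max_on
  (coord_ctsN (@coord_cts_form_vec B)) (coord_cts_rdot_mul E E) ex.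
(* [c] is the point of least norm. *)
set c := form_vec B v0 in minv0.
have Sv0 : S v0 by exact: Sle.
have [cc|cn0] := eqVneq (rdot c c) 0; first by exists v0; last exact: rdot_eq0.
have cgt0 : 0 < rdot c c by rewrite lt_neqAle eq_sym cn0 rdot_ge0.
have acute v : unit_sphere v -> rdot (E *m v) (E *m v) = spectral_norm E ^+ 2 ->
    rdot c c <= rdot (E *m v) (lincomb X (map_mx conj c) *m v).
  move=> v1 vs; rewrite rdot_lincomb_conj -/B -subr_ge0.
  pose d := form_vec B v - c.
  have -> : rdot c (form_vec B v) - rdot c c = rdot c d.
    by rewrite /d rdotDr rdotNr.
  (* The norm does not decrease when moving from [c] towards [form_vec B v]. *)
  apply: (@quadratic_ge0_slope _ _ (rdot d d)) => t t0 t1.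
  have [u [u1 us] uE] := cvx v v0 t (Logic.conj v1 vs) Sv0 (ltW t0) t1.
  have := minv0 u u1; rewrite us lexx lerN2 => /(_ isT).
  have -> : form_vec B u = c + ofR t *: d.
    rewrite uE -/c /d raddfB /= of_real1 scalerBl scale1r scalerBr.
    by rewrite addrCA addrA.
  rewrite rdot_sqrD rdotZl !rdotZr -subr_ge0.
  by congr (0 <= _); ring.
have [t] := spectral_descent n_gt0 s0 cgt0 acute.
by rewrite -lincombZ ltNge best.
Qed.

End Combinations.

Lemma convex_field_of_values (R : realType) (K : field_kind) (n m : nat)
    (B : 'I_m -> 'M[scalar_field R K]_n) (S : set 'cV_n) v w (t : R) :
    convex_set (field_of_values B S) ->
    S v -> unit_sphere v -> S w -> unit_sphere w -> 0 <= t -> t <= 1 ->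
  exists u, [/\ S u, unit_sphere u & form_vec B u =
    of_real K t *: form_vec B v + of_real K (1 - t) *: form_vec B w].
Proof.
move=> cvx Sv v1 Sw w1 t0 t1.
have l0 : 0 <= of_real K t by rewrite -(raddf0 (@of_real R K)) of_real_le.
have l1 : of_real K t <= 1 by rewrite -(@of_real1 R K) of_real_le.
have FvB : form_vec B v \in field_of_values B S by apply/mem_set; exists v.
have FwB : form_vec B w \in field_of_values B S by apply/mem_set; exists w.
have /set_mem[u [Su u1] uE] := cvx _ _ (Itv01 l0 l1) FvB FwB.
exists u; split=> //; rewrite -[LHS]/(\col_i _) uE.
by rewrite raddfB /= of_real1.
Qed.

(** [|E v|^2] is a real-linear function of the coordinates [v^H (E^H Y) v] and
    [v^H (E^H X_i) v], because [E] itself combines [Y] and the [X_i]. *)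
Lemma rdot_residual (R : realType) (K : field_kind) (n k : nat)
    (X : k.-tuple 'M[scalar_field R K]_n) (Y : 'M[scalar_field R K]_n) c v
    (E := Y - lincomb X c) :
  rdot (E *m v) (E *m v) =
  real_part ((adjoint v *m (adjoint E *m Y) *m v) 0 0) -
  rdot (map_mx (@conjF R K) c) (form_vec (fun i => adjoint E *m tnth X i) v).
Proof.
rewrite -rdot_lincomb_conj.
have -> : map_mx (@conjF R K) (map_mx (@conjF R K) c) = c.
  by apply/matrixP => i j; rewrite !mxE conjFK.
have -> : real_part ((adjoint v *m (adjoint E *m Y) *m v) 0 0) =
    rdot (E *m v) (Y *m v) by rewrite /rdot adjointM !mulmxA.
by rewrite -rdotNr -rdotDr -mulmxBl.
Qed.

Lemma form_vec_combE (R : realType) (K : field_kind) (n m : nat)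
    (B : 'I_m -> 'M[scalar_field R K]_n) v w a b i :
  (a *: form_vec B v + b *: form_vec B w) i 0 =
  a * (adjoint v *m B i *m v) 0 0 + b * (adjoint w *m B i *m w) 0 0.
Proof. by rewrite !mxE. Qed.

(** * The min-max equality *)

Lemma is_min_unique (R : realType) (T : Type) (D : set T) (f : T -> R) m m' :
  is_min D f m -> is_min D f m' -> m = m'.
Proof.
move=> [[x Dx <-] minx] [[y Dy <-] miny].
by apply/le_anti; rewrite minx ?miny.
Qed.

Theorem corollary19 (R : realType) (K : field_kind) (n k : nat)
    (X : k.-tuple 'M[scalar_field R K]_n) (XX : {vspace 'M[scalar_field R K]_n})
    (Y Xs : 'M[scalar_field R K]_n)
    (XX_span : XX = <<X>>%VS) (XX_dim : \dim XX = k)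
    (Y_notin : Y \notin XX)
    (Xs_in : Xs \in XX)
    (Xs_best : is_min [set Z | Z \in XX] (fun Z => spectral_norm (Y - Z))
                 (spectral_norm (Y - Xs)))
    (A : 'I_k -> 'M[scalar_field R K]_n)
    (A_def : forall i, A i = adjoint (Y - Xs) *m tnth X i)
    (AY : 'M[scalar_field R K]_n) (AY_def : AY = adjoint (Y - Xs) *m Y)
    (cvx : convex_set (field_of_values A (max_right_singular_span (Y - Xs)))
        \/ convex_set (field_of_values (fam_cons AY A) [set: 'cV[scalar_field R K]_n])) :
  exists (minX : 'cV[scalar_field R K]_n -> R) (maxv : 'M[scalar_field R K]_n -> R) (mu : R),
    [/\ forall v, unit_sphere v ->
          is_min [set Z | Z \in XX] (fun Z => norm2 ((Y - Z) *m v)) (minX v),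
        forall Z, Z \in XX ->
          is_max (unit_sphere : set ('cV[scalar_field R K]_n)) (fun v => norm2 ((Y - Z) *m v)) (maxv Z),
        is_max (unit_sphere : set ('cV[scalar_field R K]_n)) minX mu
      & is_min [set Z | Z \in XX] maxv mu].
Proof.
have [c0 Xs_c0] : exists c, Xs = lincomb X c.
  by apply/mem_span_lincomb; rewrite -XX_span.
have n_gt0 : (0 < n)%N.
  rewrite lt0n; apply/negP => /eqP n0; case/negP: Y_notin.
  suff -> : Y = 0 by exact: mem0v.
  by apply/matrixP => -[i lti]; exfalso; move: lti; rewrite n0.
pose E := Y - Xs; pose s := spectral_norm E.
have s_gt0 : 0 < s.
  apply: spectral_norm_gt0 => //; rewrite subr_eq0.
  by apply: contraNneq Y_notin => ->.
have best c : s <= spectral_norm (E - lincomb X c).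
  rewrite /E -addrA -opprD; apply: Xs_best.2 => /=.
  by rewrite memvD // XX_span; apply/mem_span_lincomb; exists c.
pose S v := unit_sphere v /\ rdot (E *m v) (E *m v) = s ^+ 2.
have AE : A = (fun i => adjoint E *m tnth X i) by apply/funext.
have [|v [v1 vs] v0] := exists_critical_vector n_gt0 s_gt0 best.
  move=> v w t [v1 vs] [w1 ws] t0 t1; rewrite -AE.
  case: cvx => cvx.
    have [||u [Su u1 uE]] := convex_field_of_values cvx _ v1 _ w1 t0 t1.
    - exact/max_right_singular_spanP.
    - exact/max_right_singular_spanP.
    by exists u => //; split=> //; apply/max_right_singular_spanP.
  have [u [_ u1 /colP uE]] := convex_field_of_values cvx I v1 I w1 t0 t1.
  have uA : form_vec A u =
      of_real K t *: form_vec A v + of_real K (1 - t) *: form_vec A w.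
    apply/colP => i; have := uE (lift ord0 i).
    by rewrite !mxE /fam_cons liftK.
  exists u => //; split=> //.
  have := uE ord0.
  rewrite form_vec_combE mxE /fam_cons unlift_none AY_def => uY.
  (* [|E u|^2] is the same convex combination of [|E v|^2] and [|E w|^2]. *)
  move: vs ws; rewrite /E Xs_c0 !rdot_residual -Xs_c0 -/E -AE uA uY.
  rewrite raddfD /= !re_of_realM rdotDr !rdotZr -/s.
  move=> /eqP; rewrite subr_eq => /eqP -> /eqP; rewrite subr_eq => /eqP ->.
  ring.
have orth Z : Z \in XX -> rdot (E *m v) (Z *m v) = 0.
  rewrite XX_span => /mem_span_lincomb[c ->].
  have -> : c = map_mx (@conjF R K) (map_mx (@conjF R K) c).
    by apply/matrixP => i j; rewrite !mxE conjFK.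
  by rewrite rdot_lincomb_conj v0 rdotC rdot0l.
have min_ex (w : 'cV[scalar_field R K]_n) : exists m,
    is_min [set Z | Z \in XX] (fun Z => norm2 ((Y - Z) *m w)) m.
  rewrite XX_span; have [Z XZ orthZ] := exists_orthogonal_residual X Y w.
  by exists (norm2 ((Y - Z) *m w)); exact: orthogonal_residual_min.
have [minX minXP] := boolp.choice min_ex.
exists minX, (fun Z => spectral_norm (Y - Z)), s; split => //.
- by move=> Z _; exact: spectral_norm_max.
- split; last first.
    move=> w w1; apply: le_trans ((minXP w).2 Xs Xs_in) _.
    exact: (spectral_norm_max E n_gt0).2.
  exists v => //; apply: (is_min_unique (minXP v)).
  have -> : s = norm2 (E *m v) by rewrite norm2E vs sqrtr_sqr gtr0_norm.
  by rewrite XX_span in Xs_in orth *; exact: orthogonal_residual_min.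
Qed.
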